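(* Let $G$ be a multiplicatively written abelian group, let $\phi:G\to[0,\infty)$ be a height on $G$, and let $x\in(0,\infty]$. Then: (i) $\phi_x$ is an $x$-metric height on $G$ with $\phi_x\le\phi$. (ii) If $\psi$ is an $x$-metric height on $G$ with $\psi\le\phi$, then $\psi\le\phi_x$. (iii) $\phi=\phi_x$ if and only if $\phi$ is an $x$-metric height. In particular, $(\phi_x)_x=\phi_x$. (iv) If $y\in(0,x]$, then $\phi_y\ge\phi_x$.
   Context: A (logarithmic) height on an abelian group $G$ is a function $\phi:G\to[0,\infty)$ with $\phi(1)=0$ and $\phi(\alpha)=\phi(\alpha^{-1})$ for all $\alpha\in G$. Equalities and inequalities between heights are pointwise on $G$. For real $x>0$, a height $\phi$ has the $x$-triangle inequality if $\phi(\alpha\beta)\le(\phi(\alpha)^x+\phi(\beta)^x)^{1/x}$ for all $\alpha,\beta\in G$; it has the $\infty$-triangle inequality if $\phi(\alpha\beta)\le\max\{\phi(\alpha),\phi(\beta)\}$ for all $\alpha,\beta\in G$. For $x\in(0,\infty]$, an $x$-metric height is a height with the $x$-triangle inequality. $\mathcal X(G)$ is the set of sequences $(\alpha_1,\alpha_2,\ldots)$ in $G$ with $\alpha_n=1$ for all but finitely many $n$, and $\tau:\mathcal X(G)\to G$ is $\tau(\alpha_1,\alpha_2,\ldots)=\prod_{n=1}^\infty\alpha_n$. For $x\in(0,\infty]$, put $\phi_x(\alpha_1,\alpha_2,\ldots)=\left(\sum_{n=1}^\infty\phi(\alpha_n)^x\right)^{1/x}$ if $x<\infty$ and $\phi_\infty(\alpha_1,\alpha_2,\ldots)=\max_{n\ge1}\phi(\alpha_n)$.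 The $x$-metric version of $\phi$ is the function on $G$ given by $\phi_x(\alpha)=\inf\{\phi_x(\bar\alpha):\bar\alpha\in\tau^{-1}(\alpha)\}$. *)

(* Defs.v *)
From HB Require Import structures.
From mathcomp Require Import all_boot all_order all_algebra.
From mathcomp Require Import all_classical all_reals all_analysis.

Set Implicit Arguments.
Unset Strict Implicit.
Unset Printing Implicit Defensive.

Import Order.TTheory GRing.Theory Num.Theory.

Local Open Scope classical_set_scope.
Local Open Scope ring_scope.

HB.mixin Record Group_isAbelian G of Group G := {
  mulgC : commutative ( *%g : G -> G -> G)
}.

#[short(type="abelianGroupType")]
HB.structure Definition AbelianGroup := { G of Group G & Group_isAbelian G }.

HB.instance Definition _ (G : abelianGroupType) :=
  SemiGroup.isCommutativeLaw.Build G *%g (@mulgC G).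

Section Heights.
Context {R : realType} {G : abelianGroupType}.
Implicit Types (phi : G -> R) (x : \bar R) (s : nat -> G).

Definition height phi : Prop :=
  [/\ forall a, 0 <= phi a, phi 1%g = 0 & forall a, phi a = phi a^-1%g].

(* Exponents are only meant to range over 0 < x <= +oo, so the value chosen in
   the -oo branches below is irrelevant. *)
Definition triangle_inequality x phi : Prop :=
  match x with
  | r%:E => forall a b, phi (a * b)%g <= (phi a `^ r + phi b `^ r) `^ r^-1
  | +oo%E => forall a b, phi (a * b)%g <= Num.max (phi a) (phi b)
  | -oo%E => False
  end.

Definition metric_height x phi : Prop := height phi /\ triangle_inequality x phi.

Definition finite_sequences : set (nat -> G) :=
  [set s | finite_set [set n | s n <> 1%g]].

Definition tau s : G := \big[*%g/1%g]_(n \in [set: nat]) s n.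

(* For a height phi, an exponent 0 < x and s in finite_sequences, the terms
   phi (s n) are nonnegative and almost all zero: the finitely supported sum is
   the full sum, and starting the maximum from 0 does not change it. *)
Definition seq_height phi x s : R :=
  match x with
  | r%:E => (\sum_(n \in [set: nat]) phi (s n) `^ r) `^ r^-1
  | +oo%E => \big[Num.max/0]_(n \in [set: nat]) phi (s n)
  | -oo%E => 0
  end.

Definition metric_version phi x (a : G) : R :=
  inf [set seq_height phi x s | s in finite_sequences `&` tau @^-1` [set a]].

End Heights.

(* Main.v *)
(* The x-metric version is an infimum of l^x norms over finite factorizations.
   Concatenating factorizations of a and of b gives one of a * b, whose norm is
   the l^x combination of the two norms; passing to the infimum in each argument
   gives the x-triangle inequality. Iterating the triangle inequality of an
   x-metric psi along a factorization gives maximality. The comparison of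
   exponents then needs no inequality for arbitrary sums: for y <= x the
   x-triangle inequality implies the y-triangle inequality, so phi_x is y-metric
   and maximality of phi_y applies to it. *)
Require Import Defs.
From mathcomp Require Import all_boot all_order all_algebra.
From mathcomp Require Import all_classical all_reals all_analysis.

Import Order.TTheory GRing.Theory Num.Theory.

Local Open Scope ring_scope.

(** * Finite l^x norms of real lists and their two-term form *)

Section LpNorm.
Context {R : realType}.
Implicit Types (x y : \bar R) (s t : seq R).

(* The junk value 0 at x = -oo matches the one in seq_height. *)
Definition lp_add x (u v : R) : R :=
  match x with
  | r%:E => (u `^ r + v `^ r) `^ r^-1
  | +oo%E => Num.max u v
  | -oo%E => 0
  end.

Definition lp_norm x s : R :=
  match x with
  | r%:E => (\sum_(u <- s) u `^ r) `^ r^-1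
  | +oo%E => \big[Num.max/0]_(u <- s) u
  | -oo%E => 0
  end.

Lemma powRK (r u : R) : r != 0 -> 0 <= u -> (u `^ r) `^ r^-1 = u.
Proof. by move=> r0 u0; rewrite -powRrM divff// powRr1. Qed.

Lemma powRVK (r u : R) : r != 0 -> 0 <= u -> (u `^ r^-1) `^ r = u.
Proof. by move=> r0 u0; rewrite -powRrM mulVf// powRr1. Qed.

Lemma lp_norm_ge0 x s : 0 <= lp_norm x s.
Proof.
by case: x => [r| |]//=; [exact: powR_ge0|exact: bigmax_ge_id].
Qed.

Lemma lp_norm_seq1 x (u : R) : (0 < x)%E -> 0 <= u -> lp_norm x [:: u] = u.
Proof.
case: x => [r| |]//=; last by move=> _ u0; rewrite big_seq1_id max_l.
by rewrite lte_fin => r0 u0; rewrite big_seq1 powRK ?gt_eqF.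
Qed.

Lemma lp_norm_cat x s t : (0 < x)%E ->
  lp_norm x (s ++ t) = lp_add x (lp_norm x s) (lp_norm x t).
Proof.
case: x => [r| |]//=; last first.
  move=> _; elim: s => [|u s IH]; last by rewrite cat_cons !big_cons IH maxA.
  by rewrite big_nil max_r//; exact: bigmax_ge_id.
rewrite lte_fin => r0; rewrite big_cat/=.
by rewrite !powRVK ?gt_eqF// sumr_ge0// => *; exact: powR_ge0.
Qed.

Lemma lp_norm_cons x (u : R) s : (0 < x)%E -> 0 <= u ->
  lp_norm x (u :: s) = lp_add x u (lp_norm x s).
Proof. by move=> x0 u0; rewrite -cat1s lp_norm_cat// lp_norm_seq1. Qed.

Lemma lp_addC x : commutative (lp_add x).
Proof.
case: x => [r| |] u v; rewrite /lp_add; last by [].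
  by rewrite addrC.
exact: maxC.
Qed.

Lemma ler_lp_add x (u v u' v' : R) : (0 < x)%E -> 0 <= u -> 0 <= v ->
  u <= u' -> v <= v' -> lp_add x u v <= lp_add x u' v'.
Proof.
case: x => [r| |] + u0 v0 uu' vv'; rewrite /lp_add; last by [].
  rewrite lte_fin => r0.
  have u'0 := le_trans u0 uu'; have v'0 := le_trans v0 vv'.
  apply: ge0_ler_powR; rewrite ?nnegrE ?addr_ge0 ?powR_ge0// ?invr_ge0 ?(ltW r0)//.
  by apply: lerD; apply: ge0_ler_powR; rewrite ?nnegrE ?(ltW r0)//.
by rewrite ge_max !le_max uu' vv' orbT.
Qed.

Lemma le_lp_norm x (T : Type) (f g : T -> R) (l : seq T) : (0 < x)%E ->
  (forall i, 0 <= f i) -> (forall i, f i <= g i) ->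
  lp_norm x (map f l) <= lp_norm x (map g l).
Proof.
move=> x0 f0 fg; have g0 i : 0 <= g i by exact: le_trans (f0 i) (fg i).
elim: l => [//|i l IH] /=; rewrite !lp_norm_cons//.
by apply: ler_lp_add => //; exact: lp_norm_ge0.
Qed.

Lemma ler_powR_lp_add (r u v : R) : 0 < r -> 0 <= u -> u <= lp_add r%:E u v.
Proof.
move=> r0 u0; rewrite -{1}(powRK r u) ?gt_eqF//=.
apply: ge0_ler_powR; rewrite ?nnegrE ?addr_ge0 ?powR_ge0 ?invr_ge0 ?(ltW r0)//.
by rewrite lerDl powR_ge0.
Qed.

Lemma lp_add_nonincreasing x y (u v : R) : (0 < y)%E -> (y <= x)%E ->
  0 <= u -> 0 <= v -> lp_add x u v <= lp_add y u v.
Proof.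
case: y => [q| |]//; last by case: x.
rewrite lte_fin => q0 + u0 v0.
have uM := ler_powR_lp_add q u v q0 u0.
have vM : v <= lp_add q%:E u v by rewrite lp_addC ler_powR_lp_add.
case: x => [p| |]//; last by rewrite /= ge_max uM.
rewrite lee_fin => qp; have p0 := lt_le_trans q0 qp.
(* With M = (u^q + v^q)^(1/q), u^p = u^q u^(p-q) <= u^q M^(p-q), likewise for v,
   and the two bounds add up to M^p. *)
set M := lp_add q%:E u v in uM vM *.
have M0 : 0 <= M by exact: powR_ge0.
(* This includes [w = 0]: the exponents add up to [p], which is nonzero. *)
have split_pow w : w `^ p = w `^ q * w `^ (p - q).
  by rewrite -powRD ?subrKC// gt_eqF.
rewrite /= -(powRK p M) ?gt_eqF//.
apply: ge0_ler_powR; rewrite ?nnegrE ?addr_ge0 ?powR_ge0 ?invr_ge0 ?(ltW p0)//.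
have -> : M `^ p = (u `^ q + v `^ q) * M `^ (p - q).
  by rewrite split_pow /M /= powRVK ?gt_eqF ?addr_ge0 ?powR_ge0.
rewrite mulrDl !split_pow.
by apply: lerD; rewrite ler_wpM2l ?powR_ge0// ge0_ler_powR ?nnegrE ?subr_ge0.
Qed.

(** This replaces a continuity argument for [lp_add] in its first argument: the bound on [c] is
    solved for [u], giving a lower bound of [A] that does not depend on [u], hence a lower bound of
    [inf A]. *)
Lemma le_lp_add_inf x (A : set R) (c v : R) : (0 < x)%E ->
  (A !=set0)%classic -> (forall u, A u -> 0 <= u) -> 0 <= c -> 0 <= v ->
  (forall u, A u -> c <= lp_add x u v) -> c <= lp_add x (inf A) v.
Proof.
case: x => [r| |] + An0 A0 c0 v0;
  rewrite /lp_add => + cA; last by []; last first.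
  move=> _; rewrite le_max; have [|vc] := leP c v; first by rewrite orbT.
  rewrite orbF; apply: lb_le_inf => // u /cA.
  by rewrite le_max (leNgt c v) vc orbF.
rewrite lte_fin => r0; have rn0 : r != 0 by rewrite gt_eqF.
have inf0 : 0 <= inf A by apply: lb_le_inf.
rewrite -(powRK r c)//.
apply: ge0_ler_powR; rewrite ?nnegrE ?addr_ge0 ?powR_ge0 ?invr_ge0 ?(ltW r0)//.
(* It now suffices that (c^r - v^r)^(1/r) bounds A from below when c > v. *)
rewrite -lerBlDr.
have [cv|cv] := leP (c `^ r - v `^ r) 0.
  by rewrite (le_trans cv)// powR_ge0.
rewrite -(powRVK r (c `^ r - _))// ?(ltW cv)//.
apply: ge0_ler_powR; rewrite ?nnegrE ?powR_ge0 ?(ltW r0)//.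
apply: lb_le_inf => // u Au.
rewrite -(powRK r u) ?A0//.
apply: ge0_ler_powR; rewrite ?nnegrE ?powR_ge0 ?invr_ge0 ?(ltW r0) ?(ltW cv)//.
rewrite lerBlDr -(powRVK r (_ + _)) ?addr_ge0 ?powR_ge0//.
by apply: ge0_ler_powR; rewrite ?nnegrE ?powR_ge0 ?(ltW r0)// cA.
Qed.

End LpNorm.

(** * Finitely supported sequences as lists padded by 1 *)

Section FiniteSequences.
Local Open Scope classical_set_scope.
Context {R : realType} {G : abelianGroupType}.
Implicit Types (phi psi : G -> R) (x : \bar R) (l : seq G).

Lemma finite_sequencesP (s : nat -> G) :
  finite_sequences s <-> exists l, s = nth 1%g l.
Proof.
split=> [|[l ->]]; last first.
  apply: (@sub_finite_set _ _ `I_(size l)); last exact: finite_II.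
  by move=> n /= nl; rewrite ltnNge; apply/negP => /(nth_default 1%g).
(* Here [e] lists the support. The prefix must contain its largest index, hence the successor; for
   empty [e] it is the harmless one-term list [[:: s 0]]. *)
move=> /finite_seqP[e eE]; exists (mkseq s (\max_(i <- e) i).+1).
apply/funext => n; case: (ltnP n (\max_(i <- e) i).+1) => n_e.
  by rewrite nth_mkseq.
rewrite nth_default ?size_mkseq//; apply: contrapT => sn1.
have : [set n | s n <> 1%g] n by [].
rewrite eE /= => ne; move: n_e; rewrite ltnNge.
by rewrite (@leq_bigmax_seq _ e xpredT id).
Qed.

Lemma fsbig_nth (T : Type) (idx : T) (op : Monoid.com_law idx) (f : G -> T) l :
  f 1%g = idx ->
  \big[op/idx]_(n \in [set: nat]) f (nth 1%g l n) = \big[op/idx]_(a <- l) f a.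
Proof.
move=> f1; rewrite (big_nth 1%g) big_mkord (fsbig_ord op _ (f \o nth 1%g l)).
apply/esym/fsbig_widen => // n [_ /= /negP]; rewrite -leqNgt => ln.
by rewrite /= nth_default.
Qed.

Lemma tau_nth l : tau (nth 1%g l) = (\prod_(a <- l) a)%g.
Proof. exact: (@fsbig_nth _ _ _ id). Qed.

(* Num.max is not a monoid law on R with unit 0, so fsbig_nth does not apply. *)
Lemma fsbigmax_nth phi l : (forall a, 0 <= phi a) -> phi 1%g = 0 ->
  \big[Num.max/0]_(n \in [set: nat]) phi (nth 1%g l n) =
  \big[Num.max/0]_(a <- l) phi a.
Proof.
move=> phi0 phi1; apply/le_anti/andP; split.
  apply: bigmax_le => [|n _]; first exact: bigmax_ge_id.
  case: (ltnP n (size l)) => nl; last first.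
    by rewrite nth_default// phi1; exact: bigmax_ge_id.
  by apply: (le_bigmax_seq 0 (nth 1%g l n) xpredT phi); rewrite ?mem_nth.
rewrite big_seq; apply: bigmax_le => [|a al]; first exact: bigmax_ge_id.
(* The big operator over a set only visits indices whose term differs from 0, so a zero value is
   compared with the starting value 0 instead. *)
have [->|/eqP pa0] := eqVneq (phi a) 0; first exact: bigmax_ge_id.
apply: (bigmax_sup_seq 0 (index a l)) => //; last by rewrite nth_index.
rewrite in_finite_support ?inE/=; first by rewrite nth_index.
apply: (@sub_finite_set _ _ `I_(size l)); last exact: finite_II.
move=> n [_ /= nl]; rewrite ltnNge; apply/negP => /(nth_default 1%g) n1.
by apply: nl; rewrite n1.
Qed.

Lemma seq_height_nth phi x l : height phi -> (0 < x)%E ->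
  seq_height phi x (nth 1%g l) = lp_norm x (map phi l).
Proof.
case=> phi0 phi1 _; case: x => [r| |]//= x0; rewrite big_map.
  congr (_ `^ _); rewrite (fsbig_nth _ _ _ (fun a => phi a `^ r))//.
  by rewrite phi1 powR0// gt_eqF.
exact: fsbigmax_nth.
Qed.

(** * Metric versions as infima over list factorizations *)

Definition factorization_heights phi x (a : G) : set R :=
  [set lp_norm x (map phi l) | l in [set l | (\prod_(b <- l) b)%g = a]].

Lemma metric_versionE phi x (a : G) : height phi -> (0 < x)%E ->
  metric_version phi x a = inf (factorization_heights phi x a).
Proof.
move=> hphi x0; rewrite /metric_version; congr inf; apply/seteqP; split => u.
  case=> s [/finite_sequencesP[l ->]] /=; rewrite tau_nth => la <-.
  by exists l => //; rewrite seq_height_nth.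
case=> l /= la <-; exists (nth 1%g l); last exact: seq_height_nth.
by split; [apply/finite_sequencesP; exists l|rewrite /= tau_nth].
Qed.

Lemma prodgV_abelian l : (\prod_(a <- [seq b^-1 | b <- l]) a = (\prod_(a <- l) a)^-1)%g.
Proof.
elim: l => [|a l IH] /=; first by rewrite !big_nil invg1.
by rewrite !big_cons IH invgM mulgC.
Qed.

Lemma factorization_heights_ge0 phi x (a : G) u :
  factorization_heights phi x a u -> 0 <= u.
Proof. by case=> l _ <-; exact: lp_norm_ge0. Qed.

Lemma factorization_heights_neq0 phi x (a : G) :
  factorization_heights phi x a !=set0.
Proof. by exists (lp_norm x [:: phi a]), [:: a]; rewrite //= big_seq1. Qed.

Lemma metric_version_ge0 phi x (a : G) : height phi -> (0 < x)%E ->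
  0 <= metric_version phi x a.
Proof.
move=> hphi x0; rewrite metric_versionE//.
apply: lb_le_inf; first exact: factorization_heights_neq0.
by move=> u; exact: factorization_heights_ge0.
Qed.

Lemma metric_version_le_norm phi x l : height phi -> (0 < x)%E ->
  metric_version phi x (\prod_(a <- l) a)%g <= lp_norm x (map phi l).
Proof.
move=> hphi x0; rewrite metric_versionE//; apply: ge_inf; last by exists l.
by exists 0 => u; exact: factorization_heights_ge0.
Qed.

Lemma metric_version_le phi x (a : G) : height phi -> (0 < x)%E ->
  metric_version phi x a <= phi a.
Proof.
move=> hphi x0; case: (hphi) => phi0 _ _.
have := metric_version_le_norm phi x [:: a] hphi x0.
by rewrite big_seq1 /= lp_norm_seq1.
Qed.

(** Inverting every term of a factorization of [a] gives one of its inverse with the same norm. The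
    opposite inequality is this one applied to the inverse of [a]. *)
Lemma metric_version_inv_le phi x (a : G) : height phi -> (0 < x)%E ->
  metric_version phi x a^-1%g <= metric_version phi x a.
Proof.
move=> hphi x0; case: (hphi) => _ _ phiV; rewrite [leRHS]metric_versionE//.
apply: lb_le_inf => [|u [l /= <- <-]]; first exact: factorization_heights_neq0.
rewrite -prodgV_abelian (le_trans (metric_version_le_norm _ _ _ hphi x0))//.
by rewrite -map_comp (eq_map (g := phi))// => b /=; rewrite -phiV.
Qed.

Lemma height_metric_version phi x : height phi -> (0 < x)%E ->
  height (metric_version phi x).
Proof.
move=> hphi x0; case: (hphi) => _ phi1 _.
split=> [a||a]; first exact: metric_version_ge0.
  by apply/le_anti; rewrite metric_version_ge0// -phi1 metric_version_le.
apply/le_anti; rewrite metric_version_inv_le// andbT.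
by rewrite -{1}(invgK a) metric_version_inv_le.
Qed.

(** Through [lp_add], the finite and infinite exponents are treated together from here on. *)
Lemma triangle_inequalityP phi x : (0 < x)%E ->
  triangle_inequality x phi <->
  forall a b, phi (a * b)%g <= lp_add x (phi a) (phi b).
Proof. by case: x. Qed.

Lemma metric_height_metric_version phi x : height phi -> (0 < x)%E ->
  metric_height x (metric_version phi x).
Proof.
move=> hphi x0; split; first exact: height_metric_version.
apply/triangle_inequalityP => // a b.
have ne c := factorization_heights_neq0 phi x c.
have ge0 c u := factorization_heights_ge0 phi x c u.
rewrite (metric_versionE _ _ a)//.
apply: le_lp_add_inf; rewrite ?metric_version_ge0//; first exact: ge0.
(* The infimum for [a] has become the norm of a fixed factorization [l]. Commutativity moves the
   infimum for [b] into the first slot, where [le_lp_add_inf] acts. *)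
move=> _ [l /= <- <-]; rewrite lp_addC (metric_versionE _ _ b)//.
apply: le_lp_add_inf; rewrite ?metric_version_ge0 ?lp_norm_ge0//.
  exact: ge0.
move=> _ [m /= <- <-]; rewrite lp_addC -lp_norm_cat// -map_cat -big_cat.
exact: metric_version_le_norm.
Qed.

(** * Maximality and comparison of exponents *)

Lemma metric_height_prod psi x l : (0 < x)%E -> metric_height x psi ->
  psi (\prod_(a <- l) a)%g <= lp_norm x (map psi l).
Proof.
move=> x0 [[psi0 psi1 _] /(triangle_inequalityP _ _ x0) tri].
elim: l => [|a l IH]; first by rewrite big_nil psi1 lp_norm_ge0.
by rewrite big_cons /= lp_norm_cons// (le_trans (tri _ _))// ler_lp_add.
Qed.

Lemma le_metric_version phi psi x : height phi -> (0 < x)%E ->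
  metric_height x psi -> (forall a, psi a <= phi a) ->
  forall a, psi a <= metric_version phi x a.
Proof.
move=> hphi x0 mpsi psiphi a; rewrite metric_versionE//.
apply: lb_le_inf => [|_ [l /= <- <-]]; first exact: factorization_heights_neq0.
rewrite (le_trans (metric_height_prod _ _ _ x0 mpsi))// le_lp_norm//.
by case: mpsi => [[]].
Qed.

Lemma metric_height_le_exponent psi x y : (0 < y)%E -> (y <= x)%E ->
  metric_height x psi -> metric_height y psi.
Proof.
move=> y0 yx [hpsi /(triangle_inequalityP _ _ (lt_le_trans y0 yx)) tri].
split=> //; apply/triangle_inequalityP => // a b; case: hpsi => psi0 _ _.
by rewrite (le_trans (tri a b))// lp_add_nonincreasing.
Qed.

Lemma metric_version_id phi x : height phi -> (0 < x)%E ->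
  metric_height x phi -> forall a, phi a = metric_version phi x a.
Proof.
move=> hphi x0 mphi a; apply/le_anti.
by rewrite metric_version_le// le_metric_version.
Qed.

End FiniteSequences.

Theorem theorem2p3 (R : realType) (G : abelianGroupType) (phi : G -> R)
    (hphi : height phi) (x : \bar R) (hx : (0 < x)%E) :
  [/\ metric_height x (metric_version phi x) /\
        (forall a : G, metric_version phi x a <= phi a),
      forall psi : G -> R, metric_height x psi ->
        (forall a : G, psi a <= phi a) ->
        forall a : G, psi a <= metric_version phi x a,
      ((forall a : G, phi a = metric_version phi x a) <->
         metric_height x phi) /\
        (forall a : G, metric_version (metric_version phi x) x a =
           metric_version phi x a)
    & forall y : \bar R, (0 < y)%E -> (y <= x)%E ->
        forall a : G, metric_version phi x a <= metric_version phi y a].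
Proof.
have mphix := metric_height_metric_version phi x hphi hx.
have phix_le a := metric_version_le phi x a hphi hx.
split.
- by [].
- by move=> psi; exact: le_metric_version.
- split=> [|a]; last first.
    by apply/esym; apply: metric_version_id => //; case: mphix.
  (* Extensionality turns pointwise equality into equality of functions, so [phi] inherits the
     metric property [mphix] of its metric version. *)
  by split=> [/funext ->//|]; exact: metric_version_id.
- move=> y y0 yx; apply: le_metric_version => //.
  exact: metric_height_le_exponent mphix.
Qed.
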